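(* Let $r>0$, let $X=C^0([-r,0];\mathbb{R}^n)$ with norm $\|x\|=\max_{s\in[-r,0]}|x(s)|$, let $f:X\to\mathbb{R}^n$ be Lipschitz on bounded sets of $X$ with $f(0)=0$, and let $h:X\to\mathbb{R}^k$ be continuous with $h(0)=0$. Consider the time-delay system $\dot x(t)=f(x_t)$, $x(t)\in\mathbb{R}^n$, with output $y(t)=h(x_t)$. Let $\Omega\subseteq X$ with $0\in\Omega$ be a positively invariant set for this system, and for $x_0\in\Omega$ let $\phi(t,x_0)\in\Omega$ denote the solution $x_t$ with initial condition $x_0$. Suppose that there exist a function $a\in K_\infty$, continuous functionals $V,W:\Omega\to\mathbb{R}_+$ with $\sup\{V(x)+W(x):x\in\Omega,\ \|x\|\le s\}<+\infty$ for all $s\ge0$, and a continuous, positive definite function $\rho:\mathbb{R}_+\to\mathbb{R}_+$ such that for all $x_0\in\Omega$: $$a(|h(x_0)|)\le W(x_0),$$ $$\limsup_{t\to0^+}\frac{V(\phi(t,x_0))-V(x_0)}{t}\le-\rho(W(x_0)),$$ $$\limsup_{t\to0^+}\frac{W(\phi(t,x_0))-W(x_0)}{t}\le0.$$ Then the system $\dot x(t)=f(x_t)$ with output $y(t)=h(x_t)$ is Uniformly Asymptotically Output Stable (UAOS) on $\Omega$.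
   Context: $\mathbb{R}_+=[0,+\infty)$; $|\cdot|$ is the Euclidean norm. $x_t\in X$ is defined by $(x_t)(s)=x(t+s)$ for $s\in[-r,0]$. $K_\infty$ is the class of strictly increasing continuous functions $a:\mathbb{R}_+\to\mathbb{R}_+$ with $a(0)=0$ and $\lim_{s\to+\infty}a(s)=+\infty$. A function $\rho:\mathbb{R}_+\to\mathbb{R}_+$ is positive definite if $\rho(0)=0$ and $\rho(s)>0$ for $s>0$. $\Omega$ is positively invariant if for every $x_0\in\Omega$ the solution $x_t=\phi(t,x_0)$ exists for all $t\ge0$ and $\phi(t,x_0)\in\Omega$ for all $t\ge0$. Write $y(t,x_0)=h(\phi(t,x_0))$ and $B_R=\{x\in X:\|x\|<R\}$. The system is: - Lagrange output stable on $\Omega$ if for every $R>0$ the set $\{|y(t,x_0)|:x_0\in B_R\cap\Omega,\ t\ge0\}$ is bounded; - Lyapunov output stable on $\Omega$ if for every $\varepsilon>0$ there exists $\delta(\varepsilon)>0$ such that for all $x_0\in B_{\delta(\varepsilon)}\cap\Omega$ it holds that $|y(t,x_0)|\le\varepsilon$ for all $t\ge0$; - UAOS on $\Omega$ if it is Lagrange and Lyapunov output stable on $\Omega$ and for every $\varepsilon,R>0$ there exists $T(\varepsilon,R)>0$ such that for all $x_0\in B_R\cap\Omega$ it holds that $|y(t,x_0)|\le\varepsilon$ for all $t\ge T(\varepsilon,R)$. *)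

(* Defs.v *)
From HB Require Import structures.
From mathcomp Require Import all_boot all_order all_algebra.
From mathcomp Require Import all_classical all_reals all_analysis.
From mathcomp Require Import ring lra.

Set Implicit Arguments.
Unset Strict Implicit.
Unset Printing Implicit Defensive.

Import Order.TTheory GRing.Theory Num.Theory.
Import numFieldTopology.Exports numFieldNormedType.Exports.

Local Open Scope classical_set_scope.
Local Open Scope ring_scope.

(* The library norm of ['rV[R]_n] is the maximum norm; it induces the same
   topology, so only norms (not continuity or limits) go through [enorm]. *)
Definition enorm (R : realType) (n : nat) (v : 'rV[R]_n) : R :=
  Num.sqrt (\sum_i v 0 i ^+ 2).

Section EuclideanNorm.
Variables (R : realType) (n : nat).
Implicit Types u v : 'rV[R]_n.

Lemma enorm_ge0 u : 0 <= enorm u.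
Proof. exact: sqrtr_ge0. Qed.

Lemma sqr_enorm u : enorm u ^+ 2 = \sum_i u 0 i ^+ 2.
Proof. by rewrite sqr_sqrtr// sumr_ge0// => i _; exact: sqr_ge0. Qed.

Lemma enorm0_eq0 u : enorm u = 0 -> u = 0.
Proof.
move=> u0; have /esym/eqP := sqr_enorm u.
rewrite u0 expr0n/= psumr_eq0 => [/allP h|i _]; last exact: sqr_ge0.
apply/rowP => i; rewrite mxE; apply/eqP.
by rewrite -(@sqrf_eq0 R); have := h i; rewrite mem_index_enum; apply.
Qed.

Lemma enormZ (a : R) u : enorm (a *: u) = `|a| * enorm u.
Proof.
rewrite /enorm -sqrtr_sqr -sqrtrM ?sqr_ge0// mulr_sumr; congr Num.sqrt.
by apply: eq_bigr => i _; rewrite mxE exprMn.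
Qed.

Lemma enorm0 : enorm (0 : 'rV[R]_n) = 0.
Proof. by rewrite -(scale0r 0) enormZ normr0 mul0r. Qed.

Lemma le_dot_enorm u v : \sum_i u 0 i * v 0 i <= enorm u * enorm v.
Proof.
have [/enorm0_eq0 ->|u0] := eqVneq (enorm u) 0.
  by rewrite enorm0 mul0r big1// => i _; rewrite mxE mul0r.
have [/enorm0_eq0 ->|v0] := eqVneq (enorm v) 0.
  by rewrite enorm0 mulr0 big1// => i _; rewrite mxE mulr0.
have a0 : 0 < enorm u by rewrite lt_neqAle eq_sym u0 enorm_ge0.
have b0 : 0 < enorm v by rewrite lt_neqAle eq_sym v0 enorm_ge0.
have : 0 <= \sum_i (enorm v * u 0 i - enorm u * v 0 i) ^+ 2.
  by apply: sumr_ge0 => i _; exact: sqr_ge0.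
have -> : \sum_i (enorm v * u 0 i - enorm u * v 0 i) ^+ 2 =
    enorm v ^+ 2 * (\sum_i u 0 i ^+ 2) + enorm u ^+ 2 * (\sum_i v 0 i ^+ 2)
    - 2 * (enorm u * enorm v) * (\sum_i u 0 i * v 0 i).
  by rewrite !mulr_sumr -sumrN -!big_split/=; apply: eq_bigr => i _; ring.
rewrite -!sqr_enorm => h.
rewrite -(@ler_pM2l _ (2 * (enorm u * enorm v))) ?mulr_gt0//.
nra.
Qed.

Lemma ler_enormD u v : enorm (u + v) <= enorm u + enorm v.
Proof.
rewrite -(@ler_pXn2r _ 2%N) ?nnegrE ?addr_ge0 ?enorm_ge0//.
rewrite sqrrD !sqr_enorm.
have -> : \sum_i (u + v) 0 i ^+ 2 =
    \sum_i u 0 i ^+ 2 + (\sum_i u 0 i * v 0 i) *+ 2 + \sum_i v 0 i ^+ 2.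
  by rewrite -sumrMnl -!big_split/=; apply: eq_bigr => i _; rewrite mxE sqrrD.
by rewrite lerD2r lerD2l lerMn2r le_dot_enorm.
Qed.

Lemma enorm_continuous : continuous (@enorm R n).
Proof.
have cs : continuous (fun v : 'rV[R]_n => \sum_i v 0 i ^+ 2).
  apply: continuous_big => [|i _ v]; first exact: add_continuous.
  have ci := @coord_continuous R 1 n 0 i v.
  exact: (cvgM ci ci).
by move=> v; apply: continuous_comp; [exact: cs|exact: sqrt_continuous].
Qed.

End EuclideanNorm.

(* Elements of [cspace r n] are functions of the subtype [`[- r, 0]], so that
   Leibniz equality is equality of functions on that interval. *)
Definition cspace (R : realType) (r : R) (n : nat) : Type :=
  continuousType `[- r, 0]%classic 'rV[R]_n.

Section CspaceNormedModule.
Variables (R : realType) (r : R) (n : nat).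
Local Notation I := `[- r, 0]%classic.
Local Notation X := (cspace r n).

Definition cspace_fun (x : X) : I -> 'rV[R]_n := Continuous.sort x.
Local Coercion cspace_fun : cspace >-> Funclass.

Lemma cspace_cts (x : X) : continuous (cspace_fun x).
Proof. exact: (@cts_fun _ _ x). Qed.

Definition mkcspace (x : I -> 'rV[R]_n) (cx : continuous x) : X :=
  (mkcts cx : continuousType I 'rV[R]_n).

Lemma cspaceP (x y : X) : cspace_fun x =1 cspace_fun y -> x = y.
Proof. by move=> xy; apply/continuousEP. Qed.

HB.instance Definition _ := gen_eqMixin X.
HB.instance Definition _ := gen_choiceMixin X.

Let add_cts (x y : X) : continuous (fun s => cspace_fun x s + cspace_fun y s).
Proof. by move=> s; exact: (cvgD (@cspace_cts x s) (@cspace_cts y s)). Qed.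

Let opp_cts (x : X) : continuous (fun s => - cspace_fun x s).
Proof. by move=> s; exact: (cvgN (@cspace_cts x s)). Qed.

Let scale_cts (a : R) (x : X) : continuous (fun s => a *: cspace_fun x s).
Proof. by move=> s; exact: (cvgZ (cvg_cst a) (@cspace_cts x s)). Qed.

Let zero_cts : continuous (fun _ : I => 0 : 'rV[R]_n).
Proof. exact: (@cst_continuous I 'rV[R]_n 0). Qed.

Definition cspace_zero : X := mkcspace zero_cts.
Definition cspace_add x y : X := mkcspace (@add_cts x y).
Definition cspace_opp x : X := mkcspace (@opp_cts x).
Definition cspace_scale a x : X := mkcspace (@scale_cts a x).

Let addA : associative cspace_add.
Proof. by move=> x y z; apply: cspaceP => s; exact: addrA. Qed.
Let addC : commutative cspace_add.
Proof. by move=> x y; apply: cspaceP => s; exact: addrC. Qed.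
Let add0 : left_id cspace_zero cspace_add.
Proof. by move=> x; apply: cspaceP => s; exact: add0r. Qed.
Let addN : left_inverse cspace_zero cspace_opp cspace_add.
Proof. by move=> x; apply: cspaceP => s; exact: addNr. Qed.

HB.instance Definition _ := GRing.isZmodule.Build X addA addC add0 addN.

Let scaleA a b x : cspace_scale a (cspace_scale b x) = cspace_scale (a * b) x.
Proof. by apply: cspaceP => s; exact: scalerA. Qed.
Let scale1 : left_id 1 cspace_scale.
Proof. by move=> x; apply: cspaceP => s; exact: scale1r. Qed.
Let scaleDr : right_distributive cspace_scale +%R.
Proof. by move=> a x y; apply: cspaceP => s; exact: scalerDr. Qed.
Let scaleDl x : {morph cspace_scale^~ x : a b / a + b}.
Proof. by move=> a b; apply: cspaceP => s; exact: scalerDl. Qed.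

HB.instance Definition _ :=
  GRing.Zmodule_isLmodule.Build R X scaleA scale1 scaleDr scaleDl.

(* By compactness the supremum is a maximum as soon as [0 <= r]. *)
Definition cspace_norm (x : X) : R :=
  sup [set enorm (cspace_fun x s) | s in [set: I]].

Lemma cspace_has_ubound (x : X) :
  has_ubound [set enorm (cspace_fun x s) | s in [set: I]].
Proof.
have cx : {within I, continuous (valL_ 0 (cspace_fun x))}.
  by apply/subspace_valL_continuousP'; exact: cspace_cts.
have /compact_bounded[M [_ hM]] : compact
    ((@enorm R n \o valL_ 0 (cspace_fun x)) @` I).
  apply: continuous_compact; last exact: segment_compact.
  apply: (@within_continuous_comp _ _ _ I (valL_ 0 (cspace_fun x))) => //.
  by move=> v _; exact: enorm_continuous.
exists (M + 1) => _ [s _ <-].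
apply: le_trans (ler_norm _) _; apply: (hM (M + 1)); first by rewrite ltrDl.
exists (val s); first exact: set_valP.
by rewrite /= -[in RHS](@valLK _ _ 0 I (cspace_fun x)).
Qed.

Lemma enorm_le_cspace_norm (x : X) (s : I) :
  enorm (cspace_fun x s) <= cspace_norm x.
Proof. by apply: ub_le_sup; [exact: cspace_has_ubound|exists s]. Qed.

Lemma cspace_norm_le (x : X) (c : R) : 0 <= c ->
  (forall s, enorm (cspace_fun x s) <= c) -> cspace_norm x <= c.
Proof.
move=> c0 xc; have [E0|/set0P ne] := eqVneq
    [set enorm (cspace_fun x s) | s in [set: I]] set0.
  by rewrite /cspace_norm E0 sup0.
by apply: ge_sup => // _ [s _ <-].
Qed.

Lemma cspace_norm_ge0 (x : X) : 0 <= cspace_norm x.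
Proof.
have [E0|/set0P[_ [s _ _]]] := eqVneq
    [set enorm (cspace_fun x s) | s in [set: I]] set0.
  by rewrite /cspace_norm E0 sup0.
exact: le_trans (enorm_ge0 _) (enorm_le_cspace_norm x s).
Qed.

Let normD (x y : X) : cspace_norm (x + y) <= cspace_norm x + cspace_norm y.
Proof.
apply: cspace_norm_le => [|s]; first by rewrite addr_ge0 ?cspace_norm_ge0.
by apply: le_trans (ler_enormD _ _) _; rewrite lerD ?enorm_le_cspace_norm.
Qed.

Let normZ_le (a : R) (x : X) : cspace_norm (a *: x) <= `|a| * cspace_norm x.
Proof.
apply: cspace_norm_le => [|s]; first by rewrite mulr_ge0 ?cspace_norm_ge0.
by rewrite [leLHS]enormZ ler_wpM2l ?enorm_le_cspace_norm.
Qed.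

Let normZ (a : R) (x : X) : cspace_norm (a *: x) = `|a| * cspace_norm x.
Proof.
apply/eqP; rewrite eq_le normZ_le/=; have [->|a0] := eqVneq a 0.
  by rewrite normr0 mul0r cspace_norm_ge0.
rewrite -ler_pdivlMl ?normr_gt0// -normfV.
by apply: le_trans (normZ_le _ _); rewrite scalerA mulVf// scale1r.
Qed.

Let norm0_eq0 (x : X) : cspace_norm x = 0 -> x = 0.
Proof.
move=> x0; apply: cspaceP => s; apply: enorm0_eq0.
by apply/eqP; rewrite eq_le enorm_ge0 -x0 enorm_le_cspace_norm.
Qed.

HB.instance Definition _ := Lmodule_isNormed.Build R X normD normZ norm0_eq0.

Lemma cspace_normE (x : X) :
  `|x| = sup [set enorm (cspace_fun x s) | s in [set: I]].
Proof. by []. Qed.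

End CspaceNormedModule.

Coercion cspace_fun : cspace >-> Funclass.

Section DelaySystem.
Variables (R : realType) (r : R) (n : nat).
Local Notation X := (cspace r n).

(* [history r x t] is the segment x_t; the default value 0 is used only when
   [x] is not continuous on [t - r, t]. *)
Definition history (x : R -> 'rV[R]_n) (t : R) : X :=
  xget 0 [set z : X | forall s, z s = x (t + val s)].

Lemma historyE (x : R -> 'rV[R]_n) (t : R) : 0 <= t ->
  {within `[- r, +oo[, continuous x} ->
  forall s, history x t s = x (t + val s).
Proof.
move=> t0 cx; rewrite /history; case: xgetP => [z _ //|no s0].
suff cy : continuous (fun s : `[- r, 0]%classic => x (t + val s)).
  by have := no (mkcspace cy); case.
have sJ (s : `[- r, 0]%classic) : t + val s \in `[- r, +oo[%classic.
  by have := set_valP s; rewrite inE /= !in_itv/= => /andP[? _]; lra.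
pose g (s : `[- r, 0]%classic) : `[- r, +oo[%classic :=
  exist (fun u => u \in `[- r, +oo[%classic) _ (sJ s).
have cg : continuous g.
  apply: (@continuous_comp_initial _ _ _ set_val) => s.
  have cv := @initial_continuous `[- r, 0]%classic R set_val s.
  exact: (cvgD (cvg_cst t) cv).
move=> s; move/subspace_sigL_continuousP : cx => /(_ (g s)) cx.
exact: (continuous_comp (cg s) cx).
Qed.

(* x' = f(x_t) for t >= 0 with x_0 = x0; at t = 0 the derivative is the right
   one. *)
Definition is_solution (f : X -> 'rV[R]_n) (x0 : X) (x : R -> 'rV[R]_n) : Prop :=
  [/\ {within `[- r, +oo[, continuous x},
      history x 0 = x0,
      t^-1 *: (x t - x 0) @[t --> 0^'+] --> f (history x 0) &
      forall t : R, 0 < t -> is_derive t 1 x (f (history x t))].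

(* For [f] Lipschitz on bounded sets the solution is unique, so that [get]
   selects it whenever it exists on [[0, +oo[]. *)
Definition phi (f : X -> 'rV[R]_n) (t : R) (x0 : X) : X :=
  history (get [set x | is_solution f x0 x]) t.

Definition positively_invariant (f : X -> 'rV[R]_n) (Omega : set X) : Prop :=
  forall x0, Omega x0 ->
    (exists x, is_solution f x0 x) /\
    (forall t, 0 <= t -> Omega (phi f t x0)).

Definition lipschitz_on_bounded_sets (f : X -> 'rV[R]_n) : Prop :=
  forall A : set X, bounded_set A ->
    exists L : R, forall x y, A x -> A y -> enorm (f x - f y) <= L * `|x - y|.

Section Output.
Variables (k : nat) (f : X -> 'rV[R]_n) (h : X -> 'rV[R]_k) (Omega : set X).

Definition output (t : R) (x0 : X) : 'rV[R]_k := h (phi f t x0).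

Definition open_ball (M : R) : set X := [set x | `|x| < M].

Definition lagrange_output_stable : Prop :=
  forall M, 0 < M ->
    bounded_set [set enorm (output t x0) | x0 in open_ball M `&` Omega
                                         & t in `[0, +oo[].

Definition lyapunov_output_stable : Prop :=
  forall e, 0 < e -> exists2 d, 0 < d &
    forall x0, (open_ball d `&` Omega) x0 ->
    forall t, 0 <= t -> enorm (output t x0) <= e.

Definition UAOS : Prop :=
  [/\ lagrange_output_stable, lyapunov_output_stable &
      forall e M, 0 < e -> 0 < M -> exists2 T, 0 < T &
        forall x0, (open_ball M `&` Omega) x0 ->
        forall t, T <= t -> enorm (output t x0) <= e].

End Output.
End DelaySystem.

Section ComparisonFunctions.
Variable R : realType.

(* Only the values on [[0, +oo[] matter: a function R_+ -> R_+ is encoded by a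
   function on [R]; its nonnegativity there follows from the other clauses. *)
Definition class_Kinfty (a : R -> R) : Prop :=
  [/\ {in `[0, +oo[ &, {homo a : s t / s < t}},
      {within `[0, +oo[, continuous a},
      a 0 = 0 &
      a s @[s --> +oo] --> +oo].

Definition positive_definite (rho : R -> R) : Prop :=
  rho 0 = 0 /\ forall s, 0 < s -> 0 < rho s.

End ComparisonFunctions.

(* limsup as t -> 0+ of (V(phi(t, x0)) - V(x0)) / t, in the extended reals. *)
Definition upper_dini (R : realType) (r : R) (n : nat)
    (f : cspace r n -> 'rV[R]_n) (V : cspace r n -> R) (x0 : cspace r n)
    : \bar R :=
  limf_esup (fun t => ((V (phi f t x0) - V x0) / t)%:E) 0^'+.

(* Main.v *)
(* Along a trajectory the Dini inequalities and the semigroup property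
   phi (t + s) = phi s \o phi t make W nonincreasing and V decrease at rate at
   least rho (W).
   - Lagrange stability: a (|y t|) <= W (x0), which is bounded on balls.
   - Lyapunov stability: phi t 0 = 0, so V is constant along the zero solution,
     whence rho (W 0) <= 0 and W 0 = 0; continuity of W at 0 concludes.
   - Uniform attraction: as long as W > a e, rho (W) is bounded below by the
     minimum m > 0 of rho on a compact interval, so V drops at rate m from a
     value at most S; this cannot last beyond time S / m, and afterwards
     W <= a e since W is nonincreasing.
   The semigroup property and phi t 0 = 0 rest on uniqueness of solutions. *)

Require Import Defs.
From mathcomp Require Import all_boot all_order all_algebra.
From mathcomp Require Import all_classical all_reals all_analysis.
From mathcomp Require Import ring lra.

Set Implicit Arguments.
Unset Strict Implicit.
Unset Printing Implicit Defensive.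

Import Order.TTheory GRing.Theory Num.Theory.
Import numFieldTopology.Exports numFieldNormedType.Exports.

Local Open Scope classical_set_scope.
Local Open Scope ring_scope.

(** * Right neighbourhoods of 0 and a comparison principle for Dini derivatives *)

Lemma at_right0P (R : realType) (P : R -> Prop) :
  (\forall d \near 0^'+, P d) <->
  exists2 e, 0 < e & forall d, 0 < d -> d < e -> P d.
Proof.
split=> [[e /= e0 H]|[e e0 H]].
  exists e => // d d0 de; apply: H => //=.
  by rewrite sub0r normrN gtr0_norm.
exists e => // d /= de d0; apply: H => //.
by move: de; rewrite sub0r normrN gtr0_norm.
Qed.

(* The supremum of [S] is attained by left continuity, and the Dini estimate
   there pushes [S] further to the right. *)
Lemma le_of_right_dini (R : realType) (w : R -> R) (c T : R) : 0 <= T ->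
  (forall t e : R, 0 < t -> t <= T -> 0 < e ->
    \forall d \near 0^'+, w t <= w (t - d) + e) ->
  (forall t e : R, 0 <= t -> t < T -> 0 < e ->
    \forall d \near 0^'+, w (t + d) - w t <= (c + e) * d) ->
  w T <= w 0 + c * T.
Proof.
move=> T0 left_cont dini; apply/ler_addgt0Pr => e e0.
suff [b [b0 bT bw]] : exists b, [/\ 0 < b, b * T <= e & w T <= w 0 + (c + b) * T].
  by apply: (le_trans bw); lra.
(* The slack [b] added to the slope costs at most [e] over [[0, T]]; dividing by [T + 1] also covers
   [T = 0]. *)
exists (e / (T + 1)); have T1 : 0 < T + 1 by lra.
have b0 : 0 < e / (T + 1) by rewrite divr_gt0.
split => //; first by rewrite mulrAC ler_pdivrMr//; nra.
set b := e / (T + 1) in b0 *.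
pose S := [set t | [/\ 0 <= t, t <= T & w t <= w 0 + (c + b) * t]].
have S0 : S 0 by split=> //; rewrite mulr0 addr0.
have ubS : has_ubound S by exists T => t [].
have hsS : has_sup S by split => //; exists 0.
have [s sE] : exists s, s = sup S by exists (sup S).
have s0 : 0 <= s by rewrite sE; exact: ub_le_sup.
have sT : s <= T by rewrite sE; apply: ge_sup => [|t []//]; exists 0.
have Ss : S s.
  split => //; have [->|sn0] := eqVneq s 0; first by rewrite mulr0 addr0.
  have sp : 0 < s by rewrite lt_neqAle eq_sym sn0.
  apply/ler_addgt0Pr => eta eta0.
  have eta2 : 0 < eta / 2 by rewrite divr_gt0.
  have /at_right0P[d d0 H] := left_cont s _ sp sT eta2.
  (* A point [u] of [S] within [m] of [s] is close enough for the left estimate, and the linear term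
     changes by at most [eta / 2] between [u] and [s], whatever the sign of [c + b]. *)
  pose m := Num.min d (eta / 2 / (`|c + b| + 1)).
  have c1 : 0 < `|c + b| + 1 by have := normr_ge0 (c + b); lra.
  have m0 : 0 < m by rewrite lt_min d0/= divr_gt0.
  have [u Su] := sup_adherent m0 hsS; rewrite -sE => us.
  have us' : u <= s by rewrite sE; exact: ub_le_sup.
  have [<-|un] := eqVneq u s; first by case: Su => _ _; lra.
  have lus : u < s by rewrite lt_neqAle un.
  have md : m <= d by rewrite ge_min lexx.
  have me : m <= eta / 2 / (`|c + b| + 1) by rewrite ge_min lexx orbT.
  have : w s <= w u + eta / 2.
    have := H (s - u); rewrite subKr; apply; first by rewrite subr_gt0.
    by apply: lt_le_trans md; rewrite ltrBlDr -ltrBlDl.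
  case: Su => _ _ wu.
  move: me; rewrite ler_pdivlMr// => me.
  have : - (`|c + b| * m) <= (c + b) * (s - u).
    have := ler_norm (- (c + b)); rewrite normrN => nb.
    have := normr_ge0 (c + b); nra.
  nra.
have [<-|sn] := eqVneq s T; first by case: Ss.
have lsT : s < T by rewrite lt_neqAle sn.
have /at_right0P[d d0 H] := dini s b s0 lsT b0.
(* Halving [d] gives the strict bound [m < d]. Then [s + m] lies in [S], beyond its supremum. *)
pose m := Num.min (d / 2) (T - s).
have m0 : 0 < m by rewrite lt_min divr_gt0//= subr_gt0.
have md : m <= d / 2 by rewrite ge_min lexx.
have mT : m <= T - s by rewrite ge_min lexx orbT.
have Ssm : S (s + m).
  case: Ss => _ _ ws; split; [lra|lra|].
  by have := H m m0; rewrite mulrDr; lra.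
by have := ub_le_sup ubS Ssm; rewrite -sE; lra.
Qed.

(** * Euclidean norm against coordinates, and a Gronwall-type estimate *)

Section EuclideanBounds.
Variables (R : realType) (n : nat).
Implicit Types v : 'rV[R]_n.

Lemma normr_coord_le_enorm v i : `|v 0 i| <= enorm v.
Proof.
rewrite -(@ler_pXn2r _ 2%N) ?nnegrE ?enorm_ge0// sqr_enorm real_normK ?num_real//.
by rewrite (bigD1 i)//= lerDl sumr_ge0// => j _; exact: sqr_ge0.
Qed.

(** The sharp constant is the square root of [n]; the cruder [n] follows from [n <= n ^ 2] and only
    affects the step length in [delay_gronwall]. *)
Lemma enorm_le_coord v m : 0 <= m ->
  (forall i, `|v 0 i| <= m) -> enorm v <= n%:R * m.
Proof.
move=> m0 vm; rewrite -(@ler_pXn2r _ 2%N) ?nnegrE ?enorm_ge0 ?mulr_ge0//.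
rewrite sqr_enorm exprMn.
apply: (@le_trans _ _ (\sum_(i < n) m ^+ 2)).
  apply: ler_sum => i _.
  by rewrite -[leLHS]real_normK ?num_real// ler_pXn2r ?nnegrE.
rewrite sumr_const card_ord -[leLHS]mulr_natl ler_wpM2r ?sqr_ge0//.
by rewrite -natrX ler_nat; case: (n) => // k; rewrite leq_pmulr.
Qed.

Lemma is_derive_coord (x : R -> 'rV[R]_n) (dx : 'rV[R]_n) (t : R) i :
  is_derive t 1 x dx -> is_derive t 1 (fun u => x u 0 i) (dx 0 i).
Proof.
move=> [dr <-]; apply: DeriveDef; first exact: (derivable_mxP _ _ _).1.
by rewrite derive_mx// mxE.
Qed.

Lemma within_continuous_coord (A : set R) (x : R -> 'rV[R]_n) i :
  {within A, continuous x} -> {within A, continuous (fun u => x u 0 i)}.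
Proof.
move=> cx; apply: (@within_continuous_comp _ _ _ A x (fun v : 'rV[R]_n => v 0 i)) => //.
by move=> v _; exact: coord_continuous.
Qed.

Lemma within_continuous_enorm (A : set R) (x : R -> 'rV[R]_n) :
  {within A, continuous x} -> {within A, continuous (fun u => enorm (x u))}.
Proof.
move=> cx; apply: (@within_continuous_comp _ _ _ A x (@enorm R n)) => //.
by move=> v _; exact: enorm_continuous.
Qed.

End EuclideanBounds.

(* On a short step [[a, t]] the mean value theorem bounds the maximum of
   [enorm e] by half of itself; iterating the step covers [[0, T]]. *)
Lemma delay_gronwall (R : realType) (n : nat) (e g : R -> 'rV[R]_n) (L T : R) :
  {within `[0, +oo[, continuous e} -> e 0 = 0 ->
  (forall t : R, 0 < t -> is_derive t 1 e (g t)) ->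
  (forall t M : R, 0 < t -> t <= T ->
    (forall s : R, 0 <= s -> s <= t -> enorm (e s) <= M) ->
    enorm (g t) <= L * M) ->
  forall t, 0 <= t -> t <= T -> e t = 0.
Proof.
move=> ce e0 de bound.
(* The step length makes the contraction factor at most 1/2; the summand 1 keeps the denominator
   positive when [n] or [L] is 0. *)
pose tau := (2 * (n%:R * `|L| + 1))^-1.
have nL : 0 <= n%:R * `|L| by rewrite mulr_ge0.
have tau0 : 0 < tau by rewrite invr_gt0; lra.
have ntau : n%:R * `|L| * tau <= 1 / 2.
  by rewrite /tau ler_pdivrMr; lra.
have step (k : nat) (t : R) : 0 <= t -> t <= T -> t <= k%:R * tau -> e t = 0.
  elim: k t => [|k IH] t t0 tT tk.
    by have -> : t = 0 by apply/eqP; rewrite eq_le t0 andbT -(mul0r tau).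
  have [tk'|kt] := leP t (k%:R * tau); first exact: IH.
  have sub (a b : R) : 0 <= a -> {within `[a, b], continuous e}.
    move=> a0; apply: continuous_subspaceW ce => u /=.
    by rewrite !in_itv/= andbT => /andP[au _]; exact: le_trans au.
  have [s] := EVT_max t0 (within_continuous_enorm (sub 0 t (lexx _))).
  rewrite in_itv/= => /andP[s0 st] smax.
  suff es0 : enorm (e s) <= 0.
    apply: enorm0_eq0; apply/eqP; rewrite eq_le enorm_ge0 andbT.
    by apply: le_trans es0; apply: smax; rewrite in_itv/= t0 lexx.
  (* If the maximum is attained on the part already covered, it is 0 by induction. Otherwise [s] is
     within [tau] of the last grid point [a], where [e] vanishes. *)
  have [sk|ks] := leP s (k%:R * tau).
    by rewrite IH ?enorm0//; exact: le_trans tT.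
  set a := k%:R * tau in kt ks IH.
  have a0 : 0 <= a by rewrite mulr_ge0// ltW.
  have ea : e a = 0 by apply: IH => //; lra.
  have M0 := enorm_ge0 (e s).
  have : enorm (e s) <= n%:R * (`|L| * enorm (e s) * tau).
    apply: enorm_le_coord => [|i]; first by rewrite !mulr_ge0// ltW.
    (* The mean value theorem fails for vector-valued maps, so it is applied to each coordinate,
       with [c] depending on [i]. *)
    have [|c] := @MVT _ (fun u => e u 0 i) (fun u => g u 0 i) a s ks _
        (within_continuous_coord (i := i) (sub a s a0)).
      move=> u; rewrite in_itv/= => /andP[au _].
      by apply: is_derive_coord; apply: de; exact: le_lt_trans au.
    rewrite in_itv/= => /andP[ac cs].
    rewrite ea mxE subr0 => ->; rewrite normrM (gtr0_norm (x := s - a)) ?subr_gt0//.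
    apply: ler_pM => //; first by rewrite subr_ge0 ltW.
      apply: le_trans (normr_coord_le_enorm _ _) _.
      have gc : enorm (g c) <= L * enorm (e s).
        apply: bound; [lra|lra|] => u u0 uc.
        by apply: smax; rewrite in_itv/= u0/=; lra.
      by apply: le_trans gc _; rewrite ler_wpM2r// ler_norm.
    by move: tk; rewrite -natr1 mulrDl mul1r -/a; lra.
  have half : n%:R * (`|L| * enorm (e s) * tau) <= 1 / 2 * enorm (e s).
    apply: le_trans (ler_wpM2r M0 ntau).
    by rewrite mulrA (mulrAC _ tau) !mulrA.
  by move=> /le_trans /(_ half); lra.
move=> t t0 tT; apply: (step (Num.bound (t / tau))) => //.
by rewrite -ler_pdivrMr// ltW// archi_boundP// divr_ge0// ltW.
Qed.

(** * Segments of trajectories, uniqueness of solutions and time shifts *)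

Section DelayFlow.
Variables (R : realType) (r : R) (n : nat).
Hypothesis r_gt0 : 0 < r.
Local Notation X := (cspace r n).
Implicit Types (x y : R -> 'rV[R]_n) (f : X -> 'rV[R]_n) (z : X) (t s : R).

(** Restates continuity in terms of [enorm], from which the norm of [cspace] is built, instead of
    the maximum norm. *)
Lemma within_continuous_enormP (A : set R) x : {within A, continuous x} ->
  forall t e, A t -> 0 < e ->
  \forall u \near t, A u -> enorm (x u - x t) < e.
Proof.
move=> /subspace_continuousP cx t e At e0.
have cvg_enorm : enorm (x u - x t) @[u --> within A (nbhs t)] --> (0 : R).
  rewrite -(enorm0 R n) -(subrr (x t)).
  apply: (@cvg_comp _ _ _ (fun u => x u - x t) (@enorm R n)).
    by apply: cvgB; [exact: cx|exact: cvg_cst].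
  exact: enorm_continuous.
have : within A (nbhs t) [set u | `|enorm (x u - x t)| < e].
  by move/cvgr0Pnorm_lt : cvg_enorm; apply.
rewrite {1}/within => H; near=> u => Au.
have /(_ Au) : A u -> `|enorm (x u - x t)| < e by near: u.
by apply: le_lt_trans; exact: ler_norm.
Unshelve. all: by end_near.
Qed.

Lemma history_norm_le x t M : 0 <= t -> {within `[- r, +oo[, continuous x} ->
  0 <= M -> (forall s, t - r <= s -> s <= t -> enorm (x s) <= M) ->
  `|history r x t| <= M.
Proof.
move=> t0 cx M0 xM; apply: cspace_norm_le => // s.
rewrite historyE//; have := set_valP s; rewrite /= in_itv/= => /andP[s1 s2].
by apply: xM; lra.
Qed.

(** Compactness of [[- r, T]] confines all segments up to time [T] to one ball, where a single
    Lipschitz constant of [f] is available. *)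
Lemma bounded_history x (T : R) : 0 <= T ->
  {within `[- r, +oo[, continuous x} ->
  exists M, forall t, 0 <= t -> t <= T -> `|history r x t| <= M.
Proof.
move=> T0 cx; have rT : - r <= T by move: r_gt0 => ?; lra.
have cxT : {within `[- r, T], continuous x}.
  apply: continuous_subspaceW cx => u /=.
  by rewrite !in_itv/= andbT => /andP[].
have [s _ smax] := EVT_max rT (within_continuous_enorm cxT).
exists (enorm (x s)) => t t0 tT; apply: history_norm_le => //.
  exact: enorm_ge0.
by move=> u u1 u2; apply: smax; rewrite in_itv/=; apply/andP; split; lra.
Qed.

Lemma history_eq x y t : 0 <= t ->
  {within `[- r, +oo[, continuous x} -> {within `[- r, +oo[, continuous y} ->
  (forall s, - r <= s -> x s = y s) -> history r x t = history r y t.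
Proof.
move=> t0 cx cy xy; apply: cspaceP => s.
rewrite -/(cspace_fun _) !historyE//; apply: xy.
by have := set_valP s; rewrite /= in_itv/= => /andP[]; lra.
Qed.

Lemma history_shift x t s : 0 <= t -> 0 <= s ->
  {within `[- r, +oo[, continuous x} ->
  {within `[- r, +oo[, continuous (fun u => x (u + s))} ->
  history r (fun u => x (u + s)) t = history r x (t + s).
Proof.
move=> t0 s0 cx cxs; apply: cspaceP => u.
by rewrite !historyE ?addr_ge0// addrAC.
Qed.

Lemma within_continuous_shift x s : 0 <= s ->
  {within `[- r, +oo[, continuous x} ->
  {within `[- r, +oo[, continuous (fun u => x (u + s))}.
Proof.
move=> s0 cx.
apply/subspace_continuousP => t At; move/subspace_continuousP : cx => cx.
have At' : `[- r, +oo[%classic (t + s).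
  by move: At; rewrite /= !in_itv/= !andbT; lra.
apply: (@cvg_comp _ _ _ (fun u => u + s) x _ _ _ _ (cx _ At')).
move=> P; rewrite /within/= => nP.
have cs : u + s @[u --> t] --> t + s by apply: cvgD; [exact: cvg_id|exact: cvg_cst].
have := cs _ nP; rewrite /= !near_simpl; apply: filterS => u /= H Au; apply: H.
by move: Au; rewrite /= !in_itv/= !andbT; lra.
Qed.

(** The difference vanishes on [[- r, 0]]. On [[0, t]] both histories stay in a common ball, so the
    Lipschitz bound there allows [delay_gronwall] to be applied to [x - y]. *)
Lemma solution_unique f (x0 : X) x y : lipschitz_on_bounded_sets f ->
  is_solution f x0 x -> is_solution f x0 y ->
  forall t, - r <= t -> x t = y t.
Proof.
move=> lf [cx hx _ dx] [cy hy _ dy].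
have init t : - r <= t -> t <= 0 -> x t = y t.
  move=> rt t0; have tI : t \in `[- r, 0]%classic by rewrite inE /= in_itv/= rt t0.
  have := @historyE _ r _ x 0 (lexx _) cx (exist _ t tI).
  have := @historyE _ r _ y 0 (lexx _) cy (exist _ t tI).
  by rewrite hx hy !add0r/= => -> ->.
move=> t rt; have [t0|/ltW t0] := leP t 0; first exact: init.
have [Mx xM] := bounded_history t0 cx; have [My yM] := bounded_history t0 cy.
have : bounded_set [set z : X | `|z| <= Num.max Mx My].
  by exists (Num.max Mx My); split; rewrite ?num_real// => M MM z /= /le_trans; apply; exact: ltW.
move=> /lf[L fL].
apply/eqP; rewrite -subr_eq0; apply/eqP.
have sub0 : `[0, +oo[%classic `<=` `[- r, +oo[%classic.
  by move=> u /=; rewrite !in_itv/= !andbT; apply: le_trans; rewrite oppr_le0 ltW.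
(* The constant [L] may be negative; its absolute value makes the bound monotone in the norm of the
   history difference. *)
apply: (@delay_gronwall _ _ (fun u => x u - y u)
  (fun u => f (history r x u) - f (history r y u)) `|L| t) => //.
- by move=> u; apply: cvgB; [exact: (continuous_subspaceW sub0 cx)
    |exact: (continuous_subspaceW sub0 cy)].
- by rewrite init ?subrr// oppr_le0 ltW.
- by move=> u u0; apply: is_deriveB; [exact: dx|exact: dy].
move=> u M u0 ut eM; have u0' := ltW u0.
have M0 : 0 <= M by apply: le_trans (eM u _ _) => //; exact: enorm_ge0.
apply: le_trans (fL _ _ _ _) _.
- by rewrite /= le_max xM.
- by rewrite /= le_max yM ?orbT.
apply: le_trans (ler_wpM2r (normr_ge0 _) (ler_norm L)) _.
apply: ler_wpM2l => //; apply: cspace_norm_le => // s.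
rewrite [X in enorm X](_ : _ = x (u + val s) - y (u + val s)); last first.
  by rewrite -(historyE u0' cx) -(historyE u0' cy).
have := set_valP s; rewrite /= in_itv/= => /andP[s1 s2].
(* The delay may reach back before time 0, where the two solutions agree. *)
have [us|us] := leP (u + val s) 0; last by apply: eM; [exact: ltW|rewrite gerDl].
by rewrite init ?subrr ?enorm0//; lra.
Qed.

Lemma solution_shift f (x0 : X) x s : 0 <= s ->
  is_solution f x0 x -> is_solution f (history r x s) (fun u => x (u + s)).
Proof.
move=> s0 [cx hx dx0 dx]; have cxs := within_continuous_shift s0 cx.
have hE t : 0 <= t -> history r (fun u => x (u + s)) t = history r x (t + s).
  by move=> t0; exact: history_shift.
split; first exact: cxs.
- by rewrite hE ?add0r.
(* The right derivative at the new origin is the assumed one when [s = 0], and comes from the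
   two-sided derivative when [s > 0]. *)
- rewrite (hE 0 (lexx 0)) !add0r; have [->|sn0] := eqVneq s 0.
    rewrite (_ : (fun t => _) = (fun t => t^-1 *: (x t - x 0)))//.
    by apply/funext => t; rewrite addr0.
  have sp : 0 < s by rewrite lt_neqAle eq_sym sn0.
  have [dr <-] := dx s sp.
  have E : (fun h : R => h^-1 *: ((x \o shift s) (h *: 1) - x s)) =
      (fun h => h^-1 *: (x (h + s) - x s)).
    by apply/funext => h /=; rewrite scaler1.
  by move: dr; rewrite /derivable /derive E => dr; exact: cvg_dnbhs_at_right.
move=> t t0; rewrite hE ?ltW//.
have [dr <-] := dx (t + s) (ltr_wpDr s0 t0).
have E : (fun h => h^-1 *: (((fun u => x (u + s)) \o shift t) (h *: 1) - x (t + s))) =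
    (fun h : R => h^-1 *: ((x \o shift (t + s)) (h *: 1) - x (t + s))).
  by apply/funext => h /=; rewrite addrA.
by apply: DeriveDef; rewrite /derivable /derive E.
Qed.

Lemma solution_zero f : f 0 = 0 -> is_solution f 0 (cst 0).
Proof.
move=> f0; have c0 : {within `[- r, +oo[, continuous (cst (0 : 'rV[R]_n))}.
  by apply: continuous_subspaceT => u; exact: cst_continuous.
have h0 t : 0 <= t -> history r (cst (0 : 'rV[R]_n)) t = 0.
  by move=> t0; apply: cspaceP => s; rewrite historyE.
split => //; first exact: h0.
  rewrite h0// f0; rewrite (_ : (fun t => _) = cst 0); first exact: cvg_cst.
  by apply/funext => t; rewrite subrr scaler0.
by move=> t t0; rewrite h0 ?ltW// f0; exact: is_derive_cst.
Qed.

(** The sup norm requires uniformity over the whole segment: the local estimates of continuity are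
    made uniform by compactness of [[t - r, t]]. *)
Lemma history_left_continuous x t e : 0 < t -> 0 < e ->
  {within `[- r, +oo[, continuous x} ->
  \forall d \near 0^'+, `|history r x (t - d) - history r x t| <= e.
Proof.
move=> t0 e0 cx; have e2 : 0 < e / 2 by rewrite divr_gt0.
have /compact_near_coveringP covK := @segment_compact R (t - r) t.
pose P (d u : R) := - r <= u - d -> - r <= u -> enorm (x (u - d) - x u) <= e.
have nearP : \forall d \near 0^'+, `[t - r, t]%classic `<=` P d.
  apply: covK => u; rewrite /= in_itv/= => /andP[u1 u2].
  have Au : `[- r, +oo[%classic u.
    by rewrite /= in_itv/= andbT; apply: le_trans u1; lra.
  have [eta /= eta0 H] := within_continuous_enormP cx Au e2.
  have eta2 : 0 < eta / 2 by rewrite divr_gt0.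
  (* With both radii halved, [v] and [v - d] are within [eta] of [u], so each value is within
     [e / 2] of [x u]. *)
  exists (ball u (eta / 2), [set d | 0 < d < eta / 2]).
    split => /=; first exact: nbhsx_ballx.
    by apply/at_right0P; exists (eta / 2) => // d d0 d1; apply/andP.
  move=> [v d] /= []; rewrite /ball/= => uv /andP[d0 d2] vd rv.
  have Hv : enorm (x v - x u) < e / 2.
    by apply: H; rewrite /= ?in_itv/= ?andbT// (lt_trans uv)//; lra.
  have Hvd : enorm (x (v - d) - x u) < e / 2.
    apply: H; rewrite /= ?in_itv/= ?andbT//.
    by move: uv; rewrite !ltr_norml => /andP[? ?]; apply/andP; split; lra.
  have -> : x (v - d) - x v = (x (v - d) - x u) + - (x v - x u).
    by rewrite opprB addrA subrK.
  apply: le_trans (ler_enormD _ _) _.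
  by rewrite -[- (x v - _)]scaleN1r enormZ normrN1 mul1r; lra.
have [eta eta0 H] := (at_right0P _).1 nearP.
apply/at_right0P; exists (Num.min eta t); first by rewrite lt_min eta0.
move=> d d0; rewrite lt_min => /andP[d1 d2].
have td : 0 <= t - d by rewrite subr_ge0 ltW.
apply: cspace_norm_le => [|s]; first exact: ltW.
rewrite [X in enorm X](_ : _ = x (t + val s - d) - x (t + val s)); last first.
  by rewrite addrAC -(historyE td cx) -(historyE (ltW t0) cx).
have := set_valP s; rewrite /= in_itv/= => /andP[s1 s2].
have ts1 : t - r <= t + val s by rewrite lerD2l.
have ts2 : t + val s <= t by rewrite gerDl.
apply: (H d d0 d1) => /=; first by rewrite in_itv/= ts1.
  by rewrite addrAC; apply: le_trans s1 _; rewrite lerDr.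
by apply: le_trans ts1; rewrite lerDr ltW.
Qed.

(** * The semigroup of solutions and decrease of functionals along it *)

Section Invariant.
Variables (f : X -> 'rV[R]_n) (Omega : set X).
Hypothesis lipf : lipschitz_on_bounded_sets f.

Lemma phi_solution (x0 : X) x t : is_solution f x0 x -> 0 <= t ->
  phi f t x0 = history r x t.
Proof.
move=> sx t0; have sy : [set y | is_solution f x0 y] (get [set y | is_solution f x0 y]).
  by apply: getPex; exists x.
have [cx _ _ _] := sx; have [cy _ _ _] := sy.
by apply: history_eq => //; exact: solution_unique sy sx.
Qed.

Lemma phi_zero t : f 0 = 0 -> 0 <= t -> phi f t 0 = 0.
Proof.
move=> f0 t0; have s0 := solution_zero f0.
rewrite (phi_solution s0 t0); apply: cspaceP => s; rewrite historyE//.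
by have [] := s0.
Qed.

Hypothesis invO : positively_invariant f Omega.

Lemma phi0 (x0 : X) : Omega x0 -> phi f 0 x0 = x0.
Proof.
by move=> /invO[[x sx] _]; rewrite (phi_solution sx)//; case: sx.
Qed.

(** The time-shifted trajectory solves the problem started at the segment reached at time [t], and
    by uniqueness it is the one selected by [phi]. *)
Lemma phiD (x0 : X) t s : Omega x0 -> 0 <= t -> 0 <= s ->
  phi f (t + s) x0 = phi f s (phi f t x0).
Proof.
move=> /invO[[x sx] _] t0 s0; rewrite (phi_solution sx t0).
rewrite (phi_solution (solution_shift t0 sx) s0) (phi_solution sx (addr_ge0 t0 s0)).
have [cx _ _ _] := sx.
by rewrite (history_shift s0 t0 cx (within_continuous_shift t0 cx)) (addrC s).
Qed.

Lemma phi_left_continuous (x0 : X) t e : Omega x0 -> 0 < t -> 0 < e ->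
  \forall d \near 0^'+, `|phi f (t - d) x0 - phi f t x0| <= e.
Proof.
move=> /invO[[x sx] _] t0 e0; have [cx _ _ _] := sx.
have /at_right0P[eta eta0 H] := history_left_continuous t0 e0 cx.
apply/at_right0P; exists (Num.min eta t); first by rewrite lt_min eta0.
move=> d d0; rewrite lt_min => /andP[d1 d2].
have td : 0 <= t - d by rewrite subr_ge0 ltW.
by rewrite (phi_solution sx td) (phi_solution sx (ltW t0)); exact: H.
Qed.

Lemma upper_dini_near (U : X -> R) (z : X) (c e : R) : 0 < e ->
  (upper_dini f U z <= c%:E)%E ->
  \forall d \near 0^'+, U (phi f d z) - U z <= (c + e) * d.
Proof.
move=> e0 Uz.
have : (upper_dini f U z < (c + e)%:E)%E.
  by apply: le_lt_trans Uz _; rewrite lte_fin ltrDl.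
(* The limsup is an infimum of suprema over neighbourhoods; the strict inequality gained from [e]
   selects one neighbourhood [A]. *)
move=> /ereal_inf_lt[_ [A nA <-] supA].
have [eta eta0 HA] := (at_right0P A).1 nA.
apply/at_right0P; exists eta => // d d0 de; rewrite -ler_pdivrMr//.
rewrite -lee_fin; apply: le_trans (ltW supA).
by apply: ereal_sup_ubound; exists d => //; exact: HA.
Qed.

(** An instance of [le_of_right_dini]: the semigroup property turns the Dini bound at [phi f t x0]
    into a right Dini bound at time [t], and left continuity comes from the flow and from [U] on
    [Omega]. *)
Lemma upper_dini_decrease (U : X -> R) (x0 : X) (c T : R) :
  {within Omega, continuous U} -> Omega x0 -> 0 <= T ->
  (forall t, 0 <= t -> t < T -> (upper_dini f U (phi f t x0) <= c%:E)%E) ->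
  U (phi f T x0) <= U x0 + c * T.
Proof.
move=> /subspace_continuousP cU Ox0 T0 dU.
have inO t : 0 <= t -> Omega (phi f t x0) by have [_] := invO Ox0; apply.
rewrite -[in U x0](phi0 Ox0).
apply: (@le_of_right_dini _ (fun t => U (phi f t x0))) => // t e t0 tT e0.
  have : within Omega (nbhs (phi f t x0)) [set y | `|U (phi f t x0) - U y| < e].
    by move/cvgrPdist_lt : (cU _ (inO _ (ltW t0))); apply.
  rewrite {1}/within => /nbhs_ballP[eta /= eta0 H].
  (* The flow estimate is not strict; half the radius puts the point inside the open ball. *)
  have eta2 : 0 < eta / 2 by rewrite divr_gt0.
  have /at_right0P[b b0 Hb] := phi_left_continuous Ox0 t0 eta2.
  apply/at_right0P; exists (Num.min b t); first by rewrite lt_min b0.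
  move=> d d0; rewrite lt_min => /andP[d1 d2].
  have : `|U (phi f t x0) - U (phi f (t - d) x0)| < e.
    apply: H; last by apply: inO; rewrite subr_ge0 ltW.
    rewrite -ball_normE/= distrC; apply: le_lt_trans (Hb d d0 d1) _; lra.
  by rewrite ltr_norml => /andP[_]; lra.
have /at_right0P[b b0 Hb] := upper_dini_near e0 (dU t t0 tT).
apply/at_right0P; exists b => // d d0 db.
by rewrite phiD//; [exact: Hb|exact: ltW].
Qed.

End Invariant.
End DelayFlow.

(** * Inverting comparison functions *)

Lemma class_Kinfty_le (R : realType) (a : R -> R) (s t : R) :
  class_Kinfty a -> 0 <= s -> 0 <= t -> a s <= a t -> s <= t.
Proof.
move=> [incr _ _ _] s0 t0; rewrite !leNgt; apply: contra => ts.
by apply: incr; rewrite // in_itv/= andbT.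
Qed.

Lemma class_Kinfty_bounded (R : realType) (a : R -> R) (S : R) :
  class_Kinfty a -> exists B, forall s, a s <= S -> s <= B.
Proof.
move=> [_ _ _ /cvgryPgt/(_ S)[B [_ HB]]]; exists B => s sS.
by rewrite leNgt; apply/negP => /HB; rewrite ltNge sS.
Qed.

(** * Output stability and uniform output attraction *)

Theorem corollary1 (R : realType) (r : R) (n k : nat)
    (f : cspace r n -> 'rV[R]_n) (h : cspace r n -> 'rV[R]_k)
    (Omega : set (cspace r n))
    (a rho : R -> R) (V W : cspace r n -> R) :
  0 < r ->
  lipschitz_on_bounded_sets f -> f 0 = 0 ->
  continuous h -> h 0 = 0 ->
  Omega 0 -> positively_invariant f Omega ->
  class_Kinfty a ->
  (forall x, Omega x -> 0 <= V x) -> {within Omega, continuous V} ->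
  (forall x, Omega x -> 0 <= W x) -> {within Omega, continuous W} ->
  (forall s : R, 0 <= s ->
    (ereal_sup [set (V x + W x)%:E | x in Omega `&` [set x | (`|x| <= s)%R]]
      < +oo)%E) ->
  {within `[0, +oo[, continuous rho} -> positive_definite rho ->
  (forall x0, Omega x0 -> a (enorm (h x0)) <= W x0) ->
  (forall x0, Omega x0 -> (upper_dini f V x0 <= (- rho (W x0))%:E)%E) ->
  (forall x0, Omega x0 -> (upper_dini f W x0 <= 0)%E) ->
  UAOS f h Omega.
Proof.
move=> r0 lipf f0 ch h0 O0 invO Ka V0 cV W0 cW supVW crho [_ rho_gt0] aW dV dW.
have inO x0 t : Omega x0 -> 0 <= t -> Omega (phi f t x0).
  by move=> Ox0; have [_] := invO _ Ox0; apply.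
have Wdecr x0 t : Omega x0 -> 0 <= t -> W (phi f t x0) <= W x0.
  move=> Ox0 t0; rewrite -[leRHS]addr0 -(mul0r t).
  by apply: (upper_dini_decrease r0 lipf invO cW) => // s s0 _; apply: dW; exact: inO.
have Wmono x0 s t : Omega x0 -> 0 <= s -> s <= t ->
    W (phi f t x0) <= W (phi f s x0).
  move=> Ox0 s0 st; have ts : 0 <= t - s by rewrite subr_ge0.
  rewrite -[in phi f t _](subrK s t) addrC (phiD r0 lipf invO Ox0 s0 ts).
  by apply: Wdecr => //; exact: inO.
have outW x0 t : Omega x0 -> 0 <= t -> a (enorm (output f h t x0)) <= W (phi f t x0).
  by move=> Ox0 t0; apply: aW; exact: inO.
have boundVW M : 0 <= M ->
    exists2 S, 0 <= S & forall x, Omega x -> `|x| <= M -> V x + W x <= S.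
  move=> M0; have := supVW M M0; set s := ereal_sup _ => soo.
  have sub x : Omega x -> `|x| <= M -> ((V x + W x)%:E <= s)%E.
    by move=> Ox xM; apply: ereal_sup_ubound; exists x.
  (* The point 0 of [Omega] excludes the value minus infinity for the supremum and makes [S]
     nonnegative. *)
  have s0 : ((V 0 + W 0)%:E <= s)%E by apply: sub; rewrite ?normr0.
  case: s soo sub s0 => [S _ sub s0|//|//].
  exists S; last by move=> x Ox xM; rewrite -lee_fin; exact: sub.
  by apply: le_trans (_ : V 0 + W 0 <= S) => //; rewrite addr_ge0 ?V0 ?W0.
have le_out x0 t e : Omega x0 -> 0 <= t -> 0 <= e -> W (phi f t x0) <= a e ->
    enorm (output f h t x0) <= e.
  move=> Ox0 t0 e0 We; apply: (class_Kinfty_le Ka) => //; first exact: enorm_ge0.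
  exact: le_trans (outW _ _ Ox0 t0) We.
have a_gt0 e : 0 < e -> 0 < a e.
  case: Ka => incr _ a0 _ e0; rewrite -[ltLHS]a0.
  by apply: incr; rewrite // in_itv/= andbT ?lexx// ltW.
split.
- move=> M M0; have [S S0 HS] := boundVW M (ltW M0).
  have [B HB] := class_Kinfty_bounded S Ka.
  exists B; split; first exact: num_real.
  move=> N BN _ [x0 [x0M Ox0] [t + <-]]; rewrite /= in_itv/= andbT => t0.
  rewrite ger0_norm ?enorm_ge0//; apply: le_trans (ltW BN); apply: HB.
  apply: le_trans (outW _ _ Ox0 t0) _; apply: le_trans (Wdecr _ _ Ox0 t0) _.
  by apply: le_trans (HS _ Ox0 (ltW x0M)); rewrite lerDr V0.
- move=> e e0.
  have W00 : W 0 = 0.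
    apply/eqP; rewrite eq_le W0// andbT leNgt; apply/negP => /rho_gt0 rho0.
    (* Any positive horizon gives the contradiction; 1 is taken. *)
    have /(_ 1 ler01) := upper_dini_decrease r0 lipf invO (c := - rho (W 0)) cV O0.
    rewrite (phi_zero r0 lipf f0 ler01) => H.
    suff : V 0 <= V 0 + - rho (W 0) * 1 by lra.
    by apply: H => t t0 _; rewrite (phi_zero r0 lipf f0 t0); exact: dV.
  have : within Omega (nbhs 0) [set y | `|W 0 - W y| < a e].
    move/subspace_continuousP : cW => /(_ _ O0)/cvgrPdist_lt; apply; exact: a_gt0.
  rewrite {1}/within => /nbhs_ballP[d /= d0 H].
  exists d => // x0 [x0d Ox0] t t0; apply: le_out => //; first exact: ltW.
  apply: le_trans (Wdecr _ _ Ox0 t0) _; apply: ltW.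
  have : `|W 0 - W x0| < a e.
    by apply: H => //; rewrite -ball_normE/= sub0r normrN.
  by rewrite W00 sub0r normrN; apply: le_lt_trans; exact: ler_norm.
move=> e M e0 M0; have [S S0 HS] := boundVW M (ltW M0).
have ae := a_gt0 e e0.
have [m m0 rho_ge] : exists2 m, 0 < m &
    forall w, a e <= w -> w <= S -> m <= rho w.
  (* The maximum keeps the interval nonempty when [S < a e]; its left end is positive, hence so is
     the minimum of [rho]. *)
  have ab : a e <= Num.max (a e) S by rewrite le_max lexx.
  have [|c] := @EVT_min _ rho _ _ ab.
    apply: continuous_subspaceW crho => u /=; rewrite !in_itv/= andbT.
    by case/andP => + _; apply: le_trans; exact: ltW.
  rewrite in_itv/= => /andP[ac _] cmin; exists (rho c).
    by apply: rho_gt0; exact: lt_le_trans ac.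
  by move=> w aw wS; apply: cmin; rewrite in_itv/= aw le_max wS orbT.
(* The extra unit of time gives [m * t >= S + m], which would force [V] below zero, and makes the
   time positive even if [S = 0]. *)
exists (S / m + 1); first by rewrite ltr_wpDl// divr_ge0// ltW.
move=> x0 [x0M Ox0] t Tt.
have t0 : 0 <= t by apply: le_trans Tt; rewrite addr_ge0// divr_ge0// ltW.
apply: le_out => //; first exact: ltW.
rewrite leNgt; apply/negP => Wt.
have VWS := HS _ Ox0 (ltW x0M).
have : V (phi f t x0) <= V x0 + - m * t.
  apply: (upper_dini_decrease r0 lipf invO cV) => // s s0 st.
  (* On [[0, t]] monotonicity keeps [W] between its final value, above [a e], and its initial value,
     at most [S]. *)
  apply: le_trans (dV _ (inO _ _ Ox0 s0)) _; rewrite lee_fin lerN2; apply: rho_ge.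
    by apply: le_trans (ltW Wt) _; apply: Wmono => //; exact: ltW.
  apply: le_trans (Wdecr _ _ Ox0 s0) _.
  by apply: le_trans VWS; rewrite lerDr V0.
have Vt := V0 _ (inO _ _ Ox0 t0); have Wx := W0 _ Ox0.
have : S + m <= m * t.
  have := ler_wpM2l (ltW m0) Tt.
  by rewrite mulrDr mulr1 mulrCA divff ?gt_eqF// mulr1.
by move=> H1 H2; lra.
Qed.
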